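(* Let $T>0$ and let $f \in C^1(\mathbb{R}/T\mathbb{Z} \times \mathbb{R} \times \mathbb{R}, \mathbb{R})$. Suppose there exist functions $h_1, h_2 \in C^2(\mathbb{R}/T\mathbb{Z},\mathbb{R})$ such that for all $t \in \mathbb{R}/T\mathbb{Z}$ one has $h_1(t) < h_2(t)$, $|\dot h_1(t)| < 1$, $|\dot h_2(t)| < 1$, and $$(1-\dot h_1(t)^2)^{3/2} f(t,h_1(t),\dot h_1(t)) - \ddot h_1(t) < 0,$$ $$(1-\dot h_2(t)^2)^{3/2} f(t,h_2(t),\dot h_2(t)) - \ddot h_2(t) > 0.$$ Then there exists a $T$-periodic solution $q \colon \mathbb{R}/T\mathbb{Z} \to \mathbb{R}$ of the equation $$\frac{d}{dt}\frac{\dot q}{\sqrt{1 - \dot q^2}} = f(t, q, \dot q)$$ such that $h_1(t) < q(t) < h_2(t)$ for all $t \in \mathbb{R}/T\mathbb{Z}$.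
   Context: Functions on $\mathbb{R}/T\mathbb{Z}$ are identified with $T$-periodic functions on $\mathbb{R}$ (so $f$ is $T$-periodic in its first argument), and dots denote derivatives with respect to $t$. A solution of the equation is a $C^2$ function $q$ with $|\dot q(t)|<1$ for all $t$ satisfying the equation for all $t$. *)

(* Defs.v *)
From Stdlib Require Import Reals.
From Coquelicot Require Import Coquelicot.

Open Scope R_scope.

(** Functions on [R/TZ] are represented by [T]-periodic functions on [R]. *)
Definition periodic (T : R) (g : R -> R) : Prop :=
  forall t : R, g (t + T) = g t.

(** [Derive] is total, so [ex_derive_n g n] alone does not entail
    differentiability at the lower orders; hence the quantification over [k]. *)
Definition of_class_C (n : nat) (g : R -> R) : Prop :=
  forall k : nat, (k <= n)%nat -> forall t : R,
    ex_derive_n g k t /\ continuous (Derive_n g k) t.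

(** All first-order partial derivatives exist and are jointly continuous. *)
Definition of_class_C1_3 (f : R -> R -> R -> R) : Prop :=
  (forall t x v : R,
      ex_derive (fun s => f s x v) t /\
      ex_derive (fun y => f t y v) x /\
      ex_derive (fun w => f t x w) v) /\
  (forall p : R * R * R,
      continuous (fun '(t, x, v) => Derive (fun s => f s x v) t) p /\
      continuous (fun '(t, x, v) => Derive (fun y => f t y v) x) p /\
      continuous (fun '(t, x, v) => Derive (fun w => f t x w) v) p).

Definition is_solution (f : R -> R -> R -> R) (q : R -> R) : Prop :=
  of_class_C 2 q /\
  (forall t : R, Rabs (Derive q t) < 1) /\
  (forall t : R,
      is_derive (fun s => Derive q s / sqrt (1 - Derive q s ^ 2)) t
                (f t (q t) (Derive q t))).

(* Main.v *)
(** Solving for the second derivative, the equation reads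
    [q'' = (1 - q'^2)^(3/2) f(t, q, q')].  Clipping the speed to [[-1, 1]] turns the
    right-hand side into a bounded field [g] that is Lipschitz on the strip between [h1] and
    [h2], for which [h1] and [h2] are strict lower and upper solutions.  A periodic solution is
    the limit of the monotone iteration [u_0 = h1],
    [u_{n+1}'' - k^2 u_{n+1} = g(t, u_n, u_n') - k^2 u_n] with [k] large.  The dependence on the
    velocity is controlled by the cone [|w'| <= k w]: every periodic [w] with [w'' <= k^2 w] lies
    in it, as one sees by factoring [D^2 - k^2], and on the cone the Lipschitz bound for [g] is
    absorbed by [k^2 w].  So all the differences [u_{n+1} - u_n] and [h2 - u_n] stay in the cone,
    and both [u_n] and [k u_n + u_n'] increase to limits.  The lines of slope [1] and [-1] solve
    the clipped equation, so by uniqueness a periodic solution never reaches the speed [1], and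
    clipping is harmless.  If [q] touched [h1], the cone condition and Gronwall would force
    [q = h1], against the strict inequality; likewise for [h2]. *)

Require Import Defs.
From Stdlib Require Import ZArith Reals Lra Lia List.
From Stdlib Require Import Classical IndefiniteDescription FunctionalExtensionality.
From Coquelicot Require Import Coquelicot.

Open Scope R_scope.

(** * Derivatives and the mean value theorem *)

Lemma continuous_of_is_derive (f : R -> R) (t l : R) :
  is_derive f t l -> continuous f t.
Proof. intros H; apply (ex_derive_continuous (V := R_NormedModule)); now exists l. Qed.

Lemma is_derive_eq (f : R -> R) (t l l' : R) :
  is_derive f t l -> l = l' -> is_derive f t l'.
Proof. now intros H <-. Qed.

Lemma mean_value (f f' : R -> R) (s t : R) :
  (forall x, is_derive f x (f' x)) ->
  exists c, Rmin s t <= c <= Rmax s t /\ f t - f s = f' c * (t - s).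
Proof.
  intros H. apply MVT_gen.
  - intros x _; apply H.
  - intros x _; apply continuity_pt_filterlim.
    exact (continuous_of_is_derive _ _ _ (H x)).
Qed.

Lemma mean_value_dist (s t c : R) :
  Rmin s t <= c <= Rmax s t -> Rabs (c - s) <= Rabs (t - s).
Proof.
  unfold Rmin, Rmax; destruct (Rle_dec s t); intros H;
    unfold Rabs; repeat destruct Rcase_abs; lra.
Qed.

Lemma nondecreasing_of_is_derive (f f' : R -> R) :
  (forall x, is_derive f x (f' x)) -> (forall x, 0 <= f' x) ->
  forall s t, s <= t -> f s <= f t.
Proof.
  intros H Hp s t Hst. destruct (mean_value f f' s t H) as (c & _ & E).
  specialize (Hp c). nra.
Qed.

(** * Periodic functions *)

Lemma periodic_derive (T : R) (f f' : R -> R) :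
  (forall t, is_derive f t (f' t)) -> periodic T f -> periodic T f'.
Proof.
  intros H Hp t.
  assert (E : is_derive f t (f' (t + T))).
  { apply is_derive_ext with (fun s => f (s + T)); [exact Hp|].
    eapply is_derive_eq.
    - apply (is_derive_comp (V := R_NormedModule)); [apply H|].
      apply (is_derive_plus (V := R_NormedModule));
        [apply is_derive_id | apply is_derive_const].
    - unfold scal, plus, one, zero; simpl; unfold mult; simpl; ring. }
  rewrite <- (is_derive_unique _ _ _ E). now apply is_derive_unique.
Qed.

Lemma periodic_IZR (T : R) (g : R -> R) :
  periodic T g -> forall (k : Z) (t : R), g (t + IZR k * T) = g t.
Proof.
  intros Hg.
  assert (Hn : forall (n : nat) t, g (t + INR n * T) = g t).
  { induction n as [|n IH]; intros t.
    - simpl; f_equal; ring.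
    - rewrite S_INR, <- (IH t), <- (Hg (t + INR n * T)). f_equal; ring. }
  intros k t. destruct (Z.le_gt_cases 0 k) as [Hk|Hk].
  - rewrite <- (Z2Nat.id k Hk), <- INR_IZR_INZ. apply Hn.
  - rewrite <- (Hn (Z.to_nat (- k)) (t + IZR k * T)).
    rewrite INR_IZR_INZ, Z2Nat.id by lia. rewrite opp_IZR. f_equal; ring.
Qed.

Lemma periodic_representative (T t : R) :
  0 < T -> exists s, 0 <= s <= T /\ forall g, periodic T g -> g t = g s.
Proof.
  intros HT. destruct (euclidian_division t T) as (k & s & E & Hs); [lra|].
  rewrite Rabs_pos_eq in Hs by lra.
  exists s; split; [lra|]. intros g Hg.
  rewrite E, Rplus_comm. now apply periodic_IZR.
Qed.

Lemma periodic_max (T : R) (g : R -> R) :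
  0 < T -> periodic T g -> (forall t, continuous g t) ->
  exists m, forall t, g t <= g m.
Proof.
  intros HT Hp Hc.
  destruct (continuity_ab_maj g 0 T) as (m & Hm & _); [lra| |].
  - intros c _. apply continuity_pt_filterlim, Hc.
  - exists m. intros t. destruct (periodic_representative T t HT) as (s & Hs & E).
    rewrite (E g Hp). now apply Hm.
Qed.

(** * Periodic linear equations of first and second order *)

(** Variation of constants. The free constant can be tuned to periodicity because [exp (k * T)]
    differs from 1 when [k] is nonzero. *)
Lemma periodic_first_order (T k : R) (r : R -> R) :
  0 < T -> k <> 0 -> periodic T r -> (forall t, continuous r t) ->
  exists z, periodic T z /\ forall t, is_derive z t (r t - k * z t).
Proof.
  intros HT Hk Hp Hc.
  set (I := fun t => RInt (fun s => exp (k * s) * r s) 0 t).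
  assert (Hcont : forall t, continuous (fun s => exp (k * s) * r s) t).
  { intros t. apply (continuous_mult (K := R_AbsRing)); [|apply Hc].
    apply continuous_of_is_derive with (k * exp (k * t)). auto_derive; [trivial|ring]. }
  assert (HI : forall t, is_derive I t (exp (k * t) * r t)).
  { intros t. apply (is_derive_RInt (V := R_NormedModule)
                       (fun s => exp (k * s) * r s) I 0 t); [|apply Hcont].
    apply filter_forall. intros b. apply (RInt_correct (V := R_CompleteNormedModule)).
    apply (ex_RInt_continuous (V := R_CompleteNormedModule)); intros; apply Hcont. }
  assert (HE : exp (k * T) - 1 <> 0).
  { intros E. apply Hk.
    assert (E1 : exp (k * T) = exp 0) by (rewrite exp_0; lra).
    apply exp_inv in E1. apply Rmult_integral in E1. destruct E1; lra. }
  (* [C] solves [exp (- k * T) * (C + I T) = C], that is, [z T = z 0]. *)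
  set (C := I T / (exp (k * T) - 1)).
  set (z := fun t => exp (- k * t) * (C + I t)).
  assert (Hz : forall t, is_derive z t (r t - k * z t)).
  { intros t. unfold z. eapply is_derive_eq.
    - apply (is_derive_mult (K := R_AbsRing)).
      + auto_derive; [trivial|reflexivity].
      + apply (is_derive_plus (V := R_NormedModule)); [apply is_derive_const|apply HI].
      + intros; apply Rmult_comm.
    - unfold plus, mult, zero; simpl.
      replace (- k * t) with (- (k * t)) by ring. rewrite exp_Ropp.
      field. apply Rgt_not_eq, exp_pos. }
  exists z; split; [|exact Hz].
  (* The defect [z (t+T) - z t] solves the homogeneous equation and vanishes at 0. *)
  assert (HD : forall t, is_derive (fun t => exp (k * t) * (z (t + T) - z t)) t 0).
  { intros t. eapply is_derive_eq.
    - apply (is_derive_mult (K := R_AbsRing)).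
      + auto_derive; [trivial|reflexivity].
      + apply (is_derive_minus (V := R_NormedModule)); [|apply Hz].
        apply (is_derive_comp (V := R_NormedModule)); [apply Hz|].
        auto_derive; [trivial|reflexivity].
      + intros; apply Rmult_comm.
    - unfold minus, opp, plus, mult, scal; simpl; unfold mult; simpl.
      rewrite Hp. ring. }
  intros t.
  destruct (mean_value _ (fun _ => 0) 0 t HD) as (c & _ & E).
  assert (E0 : z (0 + T) - z 0 = 0).
  { unfold z. rewrite Rplus_0_l, Rmult_0_r, exp_0.
    replace (- k * T) with (- (k * T)) by ring. rewrite exp_Ropp.
    assert (EI : I 0 = 0) by exact (RInt_point (V := R_CompleteNormedModule) 0 _).
    rewrite EI. unfold C. field. split; [exact HE|apply Rgt_not_eq, exp_pos]. }
  rewrite E0 in E. assert (0 < exp (k * t)) by apply exp_pos.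
  assert (z (t + T) - z t = 0); [|lra].
  apply Rmult_eq_reg_l with (exp (k * t)); lra.
Qed.

(** The function [exp (k * t) * z t] is nondecreasing. Comparing it at [t] and [t + T] gives
    [0 <= (exp (k * T) - 1) * z t], and the first factor has the sign of [k]. Keeping [k] in the
    conclusion serves both factors of [D^2 - k^2]. *)
Lemma periodic_first_order_sign (T k : R) (z : R -> R) (d : R -> R) :
  0 < T -> periodic T z ->
  (forall t, is_derive z t (d t)) -> (forall t, 0 <= d t + k * z t) ->
  forall t, 0 <= k * z t.
Proof.
  intros HT Hp Hz Hr t.
  assert (Hm : exp (k * t) * z t <= exp (k * (t + T)) * z (t + T)).
  { apply (nondecreasing_of_is_derive (fun t => exp (k * t) * z t)
             (fun t => exp (k * t) * (d t + k * z t))); [| |lra].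
    - intros x. eapply is_derive_eq.
      + apply (is_derive_mult (K := R_AbsRing)); [|apply Hz|].
        * auto_derive; [trivial|reflexivity].
        * intros; apply Rmult_comm.
      + unfold plus, mult; simpl. ring.
    - intros x. apply Rmult_le_pos; [left; apply exp_pos|apply Hr]. }
  rewrite Hp, Rmult_plus_distr_l, exp_plus in Hm.
  assert (He : 0 < exp (k * t)) by apply exp_pos.
  assert (Hz' : 0 <= (exp (k * T) - 1) * z t) by nra.
  destruct (Rtotal_order k 0) as [Hk|[Hk|Hk]]; [| rewrite Hk; lra |].
  - assert (exp (k * T) < 1) by (rewrite <- exp_0; apply exp_increasing; nra). nra.
  - assert (1 < exp (k * T)) by (rewrite <- exp_0; apply exp_increasing; nra). nra.
Qed.

Lemma periodic_second_order (T k : R) (r : R -> R) :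
  0 < T -> 0 < k -> periodic T r -> (forall t, continuous r t) ->
  exists u u', periodic T u /\ (forall t, is_derive u t (u' t)) /\
    forall t, is_derive u' t (k ^ 2 * u t - r t).
Proof.
  intros HT Hk Hp Hc.
  destruct (periodic_first_order T k r) as (z & Hzp & Hz); try assumption; [lra|].
  destruct (periodic_first_order T (- k) r) as (w & Hwp & Hw); try assumption; [lra|].
  (* With [z' + k z = r] and [w' - k w = r], this is the partial fraction decomposition of the
     inverse of [k^2 - D^2]. *)
  exists (fun t => (z t - w t) / (2 * k)), (fun t => - (z t + w t) / 2).
  assert (Dz : forall t, ex_derive z t) by (intros t; eexists; apply Hz).
  assert (Dw : forall t, ex_derive w t) by (intros t; eexists; apply Hw).
  assert (Ez : forall t, Derive (fun x => z x) t = r t - k * z t)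
    by (intros t; now apply is_derive_unique).
  assert (Ew : forall t, Derive (fun x => w x) t = r t - - k * w t)
    by (intros t; now apply is_derive_unique).
  split; [|split].
  - intros t. now rewrite Hzp, Hwp.
  - intros t. auto_derive; [auto|]. rewrite Ez, Ew. field. lra.
  - intros t. auto_derive; [auto|]. rewrite Ez, Ew. field. lra.
Qed.

(* [k w - w'] and [k w + w'] solve first-order inequalities: [D^2 - k^2] is factored. *)
Lemma periodic_second_order_cone (T k : R) (w w' w'' : R -> R) :
  0 < T -> 0 < k -> periodic T w ->
  (forall t, is_derive w t (w' t)) -> (forall t, is_derive w' t (w'' t)) ->
  (forall t, w'' t <= k ^ 2 * w t) ->
  forall t, Rabs (w' t) <= k * w t.
Proof.
  intros HT Hk Hp Hw Hw' Hle t.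
  assert (Hp' : periodic T w') by exact (periodic_derive T w w' Hw Hp).
  assert (D : forall c t, is_derive (fun t => c * w t - w' t) t (c * w' t - w'' t)).
  { intros c s. apply (is_derive_minus (V := R_NormedModule)); [|apply Hw'].
    apply (is_derive_scal w s c), Hw. }
  assert (Hper : forall c, periodic T (fun t => c * w t - w' t))
    by (intros c s; now rewrite Hp, Hp').
  assert (H1 : 0 <= k * (k * w t - w' t)).
  { apply (periodic_first_order_sign T k _ _ HT (Hper k) (D k)).
    intros s. specialize (Hle s). lra. }
  assert (H2 : 0 <= - k * (- k * w t - w' t)).
  { apply (periodic_first_order_sign T (- k) _ _ HT (Hper (- k)) (D (- k))).
    intros s. specialize (Hle s). lra. }
  apply Rabs_le. nra.
Qed.

(** * Gronwall uniqueness and limits of derivatives *)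

(** The derivative of [e^2] is at most [2 K e^2] in absolute value. Hence [exp (2 c t) * e^2] is
    nonincreasing for [c = - K], which settles times after [t0], and nondecreasing for [c = K],
    which settles times before it. *)
Lemma gronwall_zero (K t0 : R) (e e' : R -> R) :
  (forall t, is_derive e t (e' t)) -> (forall t, Rabs (e' t) <= K * Rabs (e t)) ->
  e t0 = 0 -> forall t, e t = 0.
Proof.
  intros He Hle H0 t.
  assert (D : forall c x, is_derive (fun x => exp (2 * c * x) * (e x) ^ 2) x
                 (exp (2 * c * x) * (2 * (c * e x ^ 2 + e x * e' x)))).
  { intros c x. assert (De : ex_derive e x) by (eexists; apply He).
    auto_derive; [auto|].
    replace (Derive (fun x => e x) x) with (e' x)
      by (symmetry; now apply is_derive_unique). ring. }
  assert (B : forall x, - (K * e x ^ 2) <= e x * e' x <= K * e x ^ 2).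
  { intros x. apply Rabs_le_between. rewrite Rabs_mult, <- (pow2_abs (e x)).
    apply Rle_trans with (Rabs (e x) * (K * Rabs (e x))); [|right; ring].
    apply Rmult_le_compat_l; [apply Rabs_pos|apply Hle]. }
  assert (Z : forall c, exp (2 * c * t) * e t ^ 2 <= exp (2 * c * t0) * e t0 ^ 2 -> e t = 0).
  { intros c Hc. rewrite H0 in Hc.
    assert (Hp : 0 < exp (2 * c * t)) by apply exp_pos.
    apply Rsqr_0_uniq. unfold Rsqr. nra. }
  destruct (Rle_dec t0 t) as [Ht|Ht].
  - apply (Z (- K)).
    enough (- (exp (2 * - K * t0) * e t0 ^ 2) <= - (exp (2 * - K * t) * e t ^ 2)) by lra.
    refine (nondecreasing_of_is_derive (fun x => - (exp (2 * - K * x) * e x ^ 2)) _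
              (fun x => is_derive_opp (V := R_NormedModule) _ _ _ (D (- K) x)) _ t0 t Ht).
    intros x. specialize (B x). unfold opp; simpl.
    assert (0 < exp (2 * - K * x)) by apply exp_pos. simpl in *. nra.
  - apply (Z K).
    refine (nondecreasing_of_is_derive _ _ (D K) _ t t0 _); [|lra].
    intros x. specialize (B x). apply Rmult_le_pos; [left; apply exp_pos|lra].
Qed.

(** The Lipschitz constant common to all [G n] bounds the first-order Taylor remainder of [F n] by
    [C * Rabs (s - t) ^ 2], uniformly in [n]. This estimate survives pointwise limits, so no uniform
    convergence has to be proved. *)
Lemma is_derive_limit (C : R) (F G : nat -> R -> R) (f g : R -> R) :
  (forall n t, is_derive (F n) t (G n t)) ->
  (forall n s t, Rabs (G n t - G n s) <= C * Rabs (t - s)) ->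
  (forall t, is_lim_seq (fun n => F n t) (f t)) ->
  (forall t, is_lim_seq (fun n => G n t) (g t)) ->
  forall t, is_derive f t (g t).
Proof.
  intros HF HG Lf Lg t.
  assert (HC : 0 <= C).
  { specialize (HG 0%nat 0 1). rewrite Rminus_0_r, Rabs_R1, Rmult_1_r in HG.
    apply Rle_trans with (2 := HG), Rabs_pos. }
  assert (Taylor : forall s, Rabs (f s - f t - g t * (s - t)) <= C * Rabs (s - t) ^ 2).
  { intros s.
    apply (is_lim_seq_le (fun n => Rabs (F n s - F n t - G n t * (s - t)))
             (fun _ => C * Rabs (s - t) ^ 2)
             (Rabs (f s - f t - g t * (s - t))) (C * Rabs (s - t) ^ 2)).
    - intros n. destruct (mean_value (F n) (G n) t s (HF n)) as (c & Hc & E).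
      rewrite E, <- Rmult_minus_distr_r, Rabs_mult.
      assert (H1 := HG n t c). assert (H2 := mean_value_dist t s c Hc).
      assert (0 <= Rabs (s - t)) by apply Rabs_pos.
      apply Rle_trans with (C * Rabs (s - t) * Rabs (s - t)); [|right; ring].
      apply Rmult_le_compat_r; [assumption|].
      apply Rle_trans with (1 := H1). now apply Rmult_le_compat_l.
    - apply (is_lim_seq_abs _ (Finite _)). apply is_lim_seq_minus'.
      + apply is_lim_seq_minus'; apply Lf.
      + apply is_lim_seq_mult'; [apply Lg|apply is_lim_seq_const].
    - apply is_lim_seq_const. }
  apply is_derive_Reals. intros eps Heps.
  (* The denominator is [C + 1] because [C] may be 0. *)
  assert (Hd : 0 < eps / (C + 1)) by (apply Rdiv_lt_0_compat; lra).
  exists (mkposreal _ Hd). intros h Hh Hlt; simpl in Hlt.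
  specialize (Taylor (t + h)). replace (t + h - t) with h in Taylor by ring.
  replace ((f (t + h) - f t) / h - g t) with ((f (t + h) - f t - g t * h) / h)
    by (field; exact Hh).
  assert (Hh' : 0 < Rabs h) by now apply Rabs_pos_lt.
  unfold Rdiv; rewrite Rabs_mult, Rabs_inv.
  apply Rle_lt_trans with (C * Rabs h).
  - apply Rmult_le_reg_r with (Rabs h); [exact Hh'|].
    rewrite Rmult_assoc, Rinv_l by lra. lra.
  - apply Rmult_lt_compat_r with (r := C + 1) in Hlt; [|lra].
    unfold Rdiv in Hlt. rewrite Rmult_assoc, Rinv_l in Hlt by lra. lra.
Qed.

(** * Lower and upper solutions in the cone order *)

(** Only the position is confined: time is handled by periodicity, and velocity by clipping. *)
Definition lipschitz_on (a b K : R) (g : R -> R -> R -> R) : Prop :=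
  forall t s x y v w, a <= x <= b -> a <= y <= b ->
    Rabs (g t x v - g s y w) <= K * (Rabs (t - s) + Rabs (x - y) + Rabs (v - w)).

(** The inequality is not strict, since the iterates have to inherit it. The strictness at [h1] and
    [h2] enters only through [cone_le_strict]. *)
Definition lower_solution (T : R) (g : R -> R -> R -> R) (u u' : R -> R) : Prop :=
  periodic T u /\ (forall t, is_derive u t (u' t)) /\
  exists u'', (forall t, is_derive u' t (u'' t)) /\ forall t, g t (u t) (u' t) <= u'' t.

Definition upper_solution (T : R) (g : R -> R -> R -> R) (u u' : R -> R) : Prop :=
  periodic T u /\ (forall t, is_derive u t (u' t)) /\
  exists u'', (forall t, is_derive u' t (u'' t)) /\ forall t, u'' t <= g t (u t) (u' t).

(** The order with positive cone [|w'| <= k w]. It is stronger than the pointwise order and lets the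
    size of a difference control its derivative. *)
Definition cone_le (k : R) (u u' v v' : R -> R) : Prop :=
  forall t, Rabs (v' t - u' t) <= k * (v t - u t).

Lemma cone_le_trans (k : R) (u u' v v' w w' : R -> R) :
  cone_le k u u' v v' -> cone_le k v v' w w' -> cone_le k u u' w w'.
Proof.
  intros H1 H2 t. specialize (H1 t). specialize (H2 t).
  replace (w' t - u' t) with ((w' t - v' t) + (v' t - u' t)) by ring.
  apply Rle_trans with (1 := Rabs_triang _ _). lra.
Qed.

Lemma cone_le_le (k : R) (u u' v v' : R -> R) :
  0 < k -> cone_le k u u' v v' -> forall t, u t <= v t.
Proof.
  intros Hk H t. specialize (H t).
  assert (0 <= Rabs (v' t - u' t)) by apply Rabs_pos. nra.
Qed.

(** In the cone the Lipschitz bound is at most [K (1 + k) (v - u)], and [K <= k - 1] gives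
    [K (1 + k) <= k^2 - 1]. *)
Lemma cone_le_lipschitz (a b K k : R) (g : R -> R -> R -> R) (u u' v v' : R -> R) (t : R) :
  0 <= K -> K + 1 <= k -> lipschitz_on a b K g ->
  cone_le k u u' v v' -> a <= u t -> v t <= b ->
  Rabs (g t (v t) (v' t) - g t (u t) (u' t)) <= k ^ 2 * (v t - u t).
Proof.
  intros HK Hk Hg Hc Ha Hb.
  assert (Hle : u t <= v t) by (apply (cone_le_le k u u' v v'); [lra|exact Hc]).
  apply Rle_trans with (1 := Hg t t _ _ _ _ (conj (Rle_trans _ _ _ Ha Hle) Hb)
                               (conj Ha (Rle_trans _ _ _ Hle Hb))).
  rewrite Rminus_diag, Rabs_R0, (Rabs_pos_eq (v t - u t)) by lra.
  set (d := v t - u t) in *. assert (Hd : 0 <= d) by (unfold d; lra).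
  apply Rle_trans with (K * (0 + d + k * d)).
  - apply Rmult_le_compat_l; [exact HK|]. specialize (Hc t). fold d in Hc. lra.
  - assert (K * (1 + k) <= k ^ 2) by nra. nra.
Qed.

Lemma continuous_lipschitz_comp (a b K : R) (g : R -> R -> R -> R) (u v : R -> R) (t : R) :
  lipschitz_on a b K g -> (forall s, a <= u s <= b) ->
  continuous u t -> continuous v t -> continuous (fun s => g s (u s) (v s)) t.
Proof.
  intros Hg Hu Cu Cv.
  set (H := fun s => K * (Rabs (s - t) + Rabs (u s - u t) + Rabs (v s - v t))).
  assert (CA : forall w : R -> R, continuous w t -> continuous (fun s => Rabs (w s - w t)) t).
  { intros w Cw. apply (continuous_comp (fun s => w s - w t) Rabs); [|apply continuous_Rabs].
    apply (continuous_minus (V := R_NormedModule)); [exact Cw|apply continuous_const]. }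
  assert (CH : continuous H t).
  { apply (continuous_scal_r (V := R_NormedModule) K).
    apply (continuous_plus (V := R_NormedModule)); [|now apply CA].
    apply (continuous_plus (V := R_NormedModule)); [|now apply CA].
    apply (CA (fun s => s)), continuous_id. }
  assert (H0 : H t = 0) by (unfold H; rewrite !Rminus_diag, Rabs_R0; ring).
  apply filterlim_locally. intros eps.
  assert (L := proj1 (filterlim_locally _ _) CH eps).
  apply filter_imp with (2 := L). intros s Hs.
  unfold ball in *; simpl in *; unfold AbsRing_ball, abs, minus, plus, opp in *; simpl in *.
  apply Rle_lt_trans with (1 := Hg s t _ _ _ _ (Hu s) (Hu t)).
  apply Rle_lt_trans with (2 := Hs). rewrite H0, Ropp_0, Rplus_0_r. apply Rle_abs.
Qed.

(** Each cone relation comes from [w'' <= k^2 w]. For [w = v - u] this is the lower-solution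
    inequality of [u]. For [w = h - v] it combines the upper-solution inequality of [h] with
    [g(h) <= g(u) + k^2 (h - u)]. That [v] is again a lower solution is
    [g(v) <= g(u) + k^2 (v - u)], available once [u] is below [v] in the cone order. *)
Lemma lower_solution_step (T a b K k : R) (g : R -> R -> R -> R)
    (u u' h h' : R -> R) :
  0 < T -> 0 <= K -> K + 1 <= k ->
  (forall x v, periodic T (fun t => g t x v)) -> lipschitz_on a b K g ->
  lower_solution T g u u' -> upper_solution T g h h' -> cone_le k u u' h h' ->
  (forall t, a <= u t) -> (forall t, h t <= b) ->
  exists v v', lower_solution T g v v' /\ cone_le k u u' v v' /\ cone_le k v v' h h' /\
    forall t, is_derive v' t (k ^ 2 * (v t - u t) + g t (u t) (u' t)).
Proof.
  intros HT HK Hk Hper Hg (Hup & Hu & u'' & Hu' & Hlow) (Hhp & Hh & h'' & Hh' & Hupp) Hc Ha Hb.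
  assert (Hk0 : 0 < k) by lra.
  assert (Hup' : periodic T u') by exact (periodic_derive T u u' Hu Hup).
  assert (Huh := cone_le_le k u u' h h' Hk0 Hc).
  assert (Hab : forall t, a <= u t <= b).
  { intros t; split; [apply Ha|]. apply Rle_trans with (h t); auto. }
  destruct (periodic_second_order T k (fun t => k ^ 2 * u t - g t (u t) (u' t)) HT Hk0)
    as (v & v' & Hvp & Hv & Hv').
  { intros t. now rewrite Hup, Hup', Hper. }
  { intros t. apply (continuous_minus (V := R_NormedModule)).
    - apply (continuous_scal_r (V := R_NormedModule) (k ^ 2) u).
      exact (continuous_of_is_derive _ _ _ (Hu t)).
    - apply (continuous_lipschitz_comp a b K); try assumption;
        eapply continuous_of_is_derive; [apply Hu|apply Hu']. }
  assert (Hv'' : forall t, is_derive v' t (k ^ 2 * (v t - u t) + g t (u t) (u' t))).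
  { intros t. eapply is_derive_eq; [apply Hv'|]. simpl; ring. }
  assert (Huv : cone_le k u u' v v').
  { intros t.
    apply (periodic_second_order_cone T k (fun t => v t - u t) (fun t => v' t - u' t)
      (fun t => k ^ 2 * (v t - u t) + g t (u t) (u' t) - u'' t)); try assumption.
    - intros s. now rewrite Hvp, Hup.
    - intros s. now apply (is_derive_minus (V := R_NormedModule)).
    - intros s. apply (is_derive_minus (V := R_NormedModule)); [apply Hv''|apply Hu'].
    - intros s. specialize (Hlow s). lra. }
  assert (Hvh : cone_le k v v' h h').
  { intros t.
    apply (periodic_second_order_cone T k (fun t => h t - v t) (fun t => h' t - v' t)
      (fun t => h'' t - (k ^ 2 * (v t - u t) + g t (u t) (u' t)))); try assumption.
    - intros s. now rewrite Hvp, Hhp.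
    - intros s. now apply (is_derive_minus (V := R_NormedModule)).
    - intros s. apply (is_derive_minus (V := R_NormedModule)); [apply Hh'|apply Hv''].
    - intros s. specialize (Hupp s).
      assert (H := cone_le_lipschitz a b K k g u u' h h' s HK Hk Hg Hc (Ha s) (Hb s)).
      apply Rabs_le_between in H. lra. }
  exists v, v'. split; [|auto].
  split; [exact Hvp|split; [exact Hv|]].
  eexists; split; [exact Hv''|]. intros t; simpl.
  assert (Hvb : v t <= b).
  { apply Rle_trans with (2 := Hb t), (cone_le_le k v v' h h' Hk0 Hvh). }
  assert (H := cone_le_lipschitz a b K k g u u' v v' t HK Hk Hg Huv (Ha t) Hvb).
  apply Rabs_le_between in H. lra.
Qed.

(** * Convergence of the monotone iteration *)

Lemma is_lim_seq_lipschitz_comp (a b K : R) (g : R -> R -> R -> R)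
    (t : R) (x y : nat -> R) (lx ly : R) :
  lipschitz_on a b K g -> (forall n, a <= x n <= b) ->
  is_lim_seq x lx -> is_lim_seq y ly ->
  is_lim_seq (fun n => g t (x n) (y n)) (g t lx ly).
Proof.
  intros Hg Hx Lx Ly.
  assert (Hl : a <= lx <= b).
  { split; [apply (is_lim_seq_le (fun _ => a) x a lx)|apply (is_lim_seq_le x (fun _ => b) lx b)];
      try (intros n; apply Hx); auto using is_lim_seq_const. }
  set (d := fun n => K * (Rabs (x n - lx) + Rabs (y n - ly))).
  assert (L0 : forall (z : nat -> R) (l : R), is_lim_seq z l -> is_lim_seq (fun n => Rabs (z n - l)) 0).
  { intros z l Lz. rewrite <- Rabs_R0, <- (Rminus_diag l).
    apply (is_lim_seq_abs _ (Finite (l - l))).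
    apply is_lim_seq_minus'; [exact Lz|apply is_lim_seq_const]. }
  assert (Ld : is_lim_seq d 0).
  { replace 0 with (K * (0 + 0)) by ring. apply is_lim_seq_mult'; [apply is_lim_seq_const|].
    apply is_lim_seq_plus'; now apply L0. }
  apply (is_lim_seq_le_le (fun n => g t lx ly - d n) _ (fun n => g t lx ly + d n)).
  - intros n. assert (H := Hg t t (x n) lx (y n) ly (Hx n) Hl).
    rewrite Rminus_diag, Rabs_R0, Rplus_0_l in H. fold (d n) in H.
    apply Rabs_le_between in H. lra.
  - replace (g t lx ly) with (g t lx ly - 0) at 1 by ring.
    apply is_lim_seq_minus'; [apply is_lim_seq_const|exact Ld].
  - replace (g t lx ly) with (g t lx ly + 0) at 1 by ring.
    apply is_lim_seq_plus'; [apply is_lim_seq_const|exact Ld].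
Qed.

Lemma cone_le_limit (k : R) (u u' v v' : nat -> R -> R) (p p' q q' : R -> R) :
  (forall n, cone_le k (u n) (u' n) (v n) (v' n)) ->
  (forall t, is_lim_seq (fun n => u n t) (p t)) ->
  (forall t, is_lim_seq (fun n => u' n t) (p' t)) ->
  (forall t, is_lim_seq (fun n => v n t) (q t)) ->
  (forall t, is_lim_seq (fun n => v' n t) (q' t)) ->
  cone_le k p p' q q'.
Proof.
  intros H Lu Lu' Lv Lv' t.
  apply (is_lim_seq_le (fun n => Rabs (v' n t - u' n t)) (fun n => k * (v n t - u n t))
           (Rabs (q' t - p' t)) (k * (q t - p t))).
  - intros n; apply H.
  - apply (is_lim_seq_abs _ (Finite _)), is_lim_seq_minus'; auto.
  - apply is_lim_seq_mult'; [apply is_lim_seq_const|]. apply is_lim_seq_minus'; auto.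
Qed.

Lemma periodic_solution_between (T a b K M B k : R) (g : R -> R -> R -> R)
    (h1 h1' h2 h2' : R -> R) :
  0 < T -> 0 <= K -> K + 1 <= k ->
  (forall x v, periodic T (fun t => g t x v)) -> lipschitz_on a b K g ->
  (forall t x v, a <= x <= b -> Rabs (g t x v) <= M) ->
  (forall t, Rabs (h1' t) <= B) ->
  (forall t, a <= h1 t) -> (forall t, h2 t <= b) ->
  lower_solution T g h1 h1' -> upper_solution T g h2 h2' -> cone_le k h1 h1' h2 h2' ->
  exists q p, periodic T q /\ (forall t, is_derive q t (p t)) /\
    (forall t, is_derive p t (g t (q t) (p t))) /\
    cone_le k h1 h1' q p /\ cone_le k q p h2 h2'.
Proof.
  intros HT HK Hk Hper Hg HM HB Ha Hb Hlow Hupp H12.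
  assert (Hk0 : 0 < k) by lra.
  set (Good := fun s : (R -> R) * (R -> R) =>
    lower_solution T g (fst s) (snd s) /\
    cone_le k h1 h1' (fst s) (snd s) /\ cone_le k (fst s) (snd s) h2 h2').
  assert (Hbox : forall s, Good s -> forall t, a <= fst s t <= b).
  { intros s (_ & H1 & H2) t. split.
    - apply Rle_trans with (h1 t); [apply Ha|]. now apply (cone_le_le k _ _ _ _ Hk0 H1).
    - apply Rle_trans with (h2 t); [|apply Hb]. now apply (cone_le_le k _ _ _ _ Hk0 H2). }
  destruct (functional_choice (fun s s' : (R -> R) * (R -> R) => Good s ->
    Good s' /\ cone_le k (fst s) (snd s) (fst s') (snd s') /\
    forall t, is_derive (snd s') t
      (k ^ 2 * (fst s' t - fst s t) + g t (fst s t) (snd s t)))) as (step & Hstep).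
  (* Choice needs a successor for every pair, so a pair that is not [Good] gets a dummy one. *)
  { intros s. destruct (classic (Good s)) as [Hs|Hs]; [|exists s; tauto].
    assert (Hs' := Hs). destruct Hs' as (L1 & C1 & C2).
    destruct (lower_solution_step T a b K k g (fst s) (snd s) h2 h2')
      as (v & v' & L & C3 & C4 & D); try assumption.
    - intros t. apply (Hbox s Hs).
    - exists (v, v'). intros _. split; [|auto]. split; [exact L|split; [|exact C4]].
      exact (cone_le_trans k _ _ _ _ _ _ C1 C3). }
  set (s := fun n => Nat.iter n step (h1, h1')).
  assert (Hgood : forall n, Good (s n)).
  { induction n as [|n IH]; [|exact (proj1 (Hstep _ IH))].
    split; [exact Hlow|split; [|exact H12]].
    intros t; simpl. rewrite !Rminus_diag, Rabs_R0. lra. }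
  set (u := fun n => fst (s n)). set (u' := fun n => snd (s n)).
  (* Mind the shift: [u'' n] is the derivative of [u' (S n)]. *)
  set (u'' := fun n t => k ^ 2 * (u (S n) t - u n t) + g t (u n t) (u' n t)).
  assert (Hu : forall n t, is_derive (u n) t (u' n t))
    by (intros n; apply (Hgood n)).
  assert (Hu' : forall n t, is_derive (u' (S n)) t (u'' n t))
    by (intros n; apply (Hstep _ (Hgood n))).
  assert (Hcone : forall n, cone_le k (u n) (u' n) (u (S n)) (u' (S n)))
    by (intros n; apply (Hstep _ (Hgood n))).
  assert (Hub : forall n t, a <= u n t <= b) by (intros n; apply (Hbox _ (Hgood n))).
  (* The cone bounds [u' n - h1'] by [k (u n - h1)], hence by [k (b - a)]. *)
  set (B1 := B + k * (b - a)).
  assert (Hu'b : forall n t, Rabs (u' n t) <= B1).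
  { intros n t. destruct (Hgood n) as (_ & C & _). specialize (C t).
    fold (u n) (u' n) in C. specialize (Hub n t). specialize (Ha t). specialize (HB t).
    replace (u' n t) with ((u' n t - h1' t) + h1' t) by ring.
    apply Rle_trans with (1 := Rabs_triang _ _). unfold B1. nra. }
  set (M1 := k ^ 2 * (b - a) + M).
  assert (Hu''b : forall n t, Rabs (u'' n t) <= M1).
  { intros n t. unfold u'', M1. apply Rle_trans with (1 := Rabs_triang _ _).
    apply Rplus_le_compat; [|apply HM, Hub].
    rewrite Rabs_mult, Rabs_pos_eq by apply pow2_ge_0.
    apply Rmult_le_compat_l; [apply pow2_ge_0|].
    assert (H1 := Hub n t). assert (H2 := Hub (S n) t).
    apply Rabs_le. lra. }
  assert (Lip : forall (f f' : R -> R) C, (forall t, is_derive f t (f' t)) ->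
     (forall t, Rabs (f' t) <= C) -> forall x y, Rabs (f y - f x) <= C * Rabs (y - x)).
  { intros f f' C Hf HC x y. destruct (mean_value f f' x y Hf) as (c & _ & E).
    rewrite E, Rabs_mult. apply Rmult_le_compat_r; [apply Rabs_pos|apply HC]. }
  (* A Lipschitz constant in time for [u'' (S n)], with [B1] serving for [u] and [M1] for [u']. The
     index 0 is left out: [u'' 0] involves [h1'], for which no Lipschitz constant is at hand. *)
  set (C := 2 * k ^ 2 * B1 + K * (1 + B1 + M1)).
  assert (Hu''lip : forall n x y, Rabs (u'' (S n) y - u'' (S n) x) <= C * Rabs (y - x)).
  { intros n x y.
    assert (L1 := Lip _ _ _ (Hu (S n)) (Hu'b (S n)) x y).
    assert (L2 := Lip _ _ _ (Hu (S (S n))) (Hu'b (S (S n))) x y).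
    assert (L3 := Lip _ _ _ (Hu' n) (Hu''b n) x y).
    assert (L4 := Hg y x _ _ (u' (S n) y) (u' (S n) x) (Hub (S n) y) (Hub (S n) x)).
    unfold u''.
    replace (_ - _) with (k ^ 2 * ((u (S (S n)) y - u (S (S n)) x) - (u (S n) y - u (S n) x))
       + (g y (u (S n) y) (u' (S n) y) - g x (u (S n) x) (u' (S n) x))) by ring.
    apply Rle_trans with (1 := Rabs_triang _ _).
    replace (C * Rabs (y - x)) with
      (k ^ 2 * (B1 * Rabs (y - x) + B1 * Rabs (y - x)) +
       K * (Rabs (y - x) + B1 * Rabs (y - x) + M1 * Rabs (y - x))) by (unfold C; ring).
    apply Rplus_le_compat.
    - rewrite Rabs_mult, Rabs_pos_eq by apply pow2_ge_0.
      apply Rmult_le_compat_l; [apply pow2_ge_0|].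
      unfold Rminus at 1. apply Rle_trans with (1 := Rabs_triang _ _).
      rewrite Rabs_Ropp. lra.
    - apply Rle_trans with (1 := L4). apply Rmult_le_compat_l; lra. }
  assert (Hlu : forall t, exists l : R, is_lim_seq (fun n => u n t) l).
  { intros t. apply (ex_finite_lim_seq_incr _ b); intros n; [|apply Hub].
    apply (cone_le_le k _ _ _ _ Hk0 (Hcone n)). }
  (* [k u_n + u_n'] is nondecreasing as well, since [u_{n+1} - u_n] lies in the cone. *)
  assert (Hlu' : forall t, exists l : R, is_lim_seq (fun n => u' n t) l).
  { intros t. destruct (Hlu t) as (l & Hl).
    destruct (ex_finite_lim_seq_incr (fun n => k * u n t + u' n t) (k * b + B1)) as (m & Hm).
    - intros n. assert (H := Hcone n t). apply Rabs_le_between in H. lra.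
    - intros n. assert (H1 := Hu'b n t). apply Rabs_le_between in H1.
      assert (H2 := Hub n t). nra.
    - exists (m - k * l). apply is_lim_seq_ext with (fun n => (k * u n t + u' n t) - k * u n t).
      + intros n; ring.
      + apply is_lim_seq_minus'; [exact Hm|].
        apply is_lim_seq_mult'; [apply is_lim_seq_const|exact Hl]. }
  destruct (functional_choice _ Hlu) as (q & Hq).
  destruct (functional_choice _ Hlu') as (p & Hp).
  assert (Lu'' : forall t, is_lim_seq (fun n => u'' n t) (g t (q t) (p t))).
  { intros t. unfold u''.
    replace (g t (q t) (p t)) with (k ^ 2 * (q t - q t) + g t (q t) (p t)) by ring.
    apply is_lim_seq_plus'.
    - apply is_lim_seq_mult'; [apply is_lim_seq_const|].
      apply is_lim_seq_minus'; [|apply Hq].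
      apply (is_lim_seq_incr_1 (fun n => u n t)), Hq.
    - apply (is_lim_seq_lipschitz_comp a b K); auto. }
  exists q, p. split; [|split; [|split]].
  - intros t. assert (E := is_lim_seq_ext _ (fun n => u n t) _
      (fun n => proj1 (proj1 (Hgood n)) t) (Hq (t + T))).
    apply is_lim_seq_unique in E. rewrite (is_lim_seq_unique _ _ (Hq t)) in E.
    now injection E.
  - apply (is_derive_limit M1 (fun n => u (S n)) (fun n => u' (S n))); auto.
    + intros n x y. exact (Lip _ _ _ (Hu' n) (Hu''b n) x y).
    + intros t. apply (is_lim_seq_incr_1 (fun n => u n t)), Hq.
    + intros t. apply (is_lim_seq_incr_1 (fun n => u' n t)), Hp.
  - apply (is_derive_limit C (fun n => u' (S (S n))) (fun n => u'' (S n))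
             p (fun t => g t (q t) (p t))); auto.
    + intros t. apply (is_lim_seq_incr_1 (fun n => u' (S n) t)), (is_lim_seq_incr_1 (fun n => u' n t)), Hp.
    + intros t. apply (is_lim_seq_incr_1 (fun n => u'' n t)), Lu''.
  - split.
    + apply (cone_le_limit k (fun _ => h1) (fun _ => h1') u u');
        auto using is_lim_seq_const. intros n; apply (Hgood n).
    + apply (cone_le_limit k u u' (fun _ => h2) (fun _ => h2'));
        auto using is_lim_seq_const. intros n; apply (Hgood n).
Qed.

(** * Bounds and Lipschitz estimates for a periodic field of class C^1 *)

(** Around each point [F] grows by at most 1 in absolute value, and finitely many such
    neighbourhoods cover the box. [compactness_list] gives this cover under a double negation and
    for nested tuples [Tn 3 R], hence [NNPP] and [G]. *)
Lemma continuous_box_bounded (F : R * R * R -> R) (a1 b1 a2 b2 a3 b3 : R) :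
  (forall p, continuous F p) ->
  exists L, forall t x v, a1 <= t <= b1 -> a2 <= x <= b2 -> a3 <= v <= b3 ->
    Rabs (F (t, x, v)) <= L.
Proof.
  intros HF.
  set (G := fun z : Compactness.Tn 3 R => F (fst z, fst (snd z), fst (snd (snd z)))).
  assert (Hd : forall z : Compactness.Tn 3 R, exists d : posreal,
             forall z', close_n 3 d z' z -> Rabs (G z') <= Rabs (G z) + 1).
  { intros (t & x & v & []).
    destruct (proj1 (filterlim_locally F _) (HF (t, x, v)) (mkposreal 1 Rlt_0_1)) as (d & Hd).
    exists d. intros (t' & x' & v' & []) (H1 & H2 & H3 & _).
    assert (H : ball (F (t, x, v)) 1 (F (t', x', v'))).
    { apply Hd. now split; [split|]. }
    unfold G; simpl.
    replace (F (t', x', v')) with (F (t', x', v') - F (t, x, v) + F (t, x, v)) by ring.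
    apply Rle_trans with (1 := Rabs_triang _ _).
    assert (H' : Rabs (F (t', x', v') - F (t, x, v)) < 1) by exact H. lra. }
  destruct (functional_choice _ Hd) as (delta & Hdelta).
  assert (Hmax : forall l : list (Compactness.Tn 3 R), exists L, forall z, In z l -> Rabs (G z) + 1 <= L).
  { induction l as [|z l (L & IH)]; [now exists 0|].
    exists (Rmax (Rabs (G z) + 1) L). intros y [<-|Hy]; [apply Rmax_l|].
    apply Rle_trans with (2 := Rmax_r _ _). now apply IH. }
  destruct (NNPP _ (compactness_list 3 (a1, (a2, (a3, tt))) (b1, (b2, (b3, tt))) delta))
    as (l & Hl).
  destruct (Hmax l) as (L & HL). exists L. intros t x v Ht Hx Hv.
  destruct (Hl (t, (x, (v, tt)))) as (z & Hz & _ & Hc); [now repeat split|].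
  apply Rle_trans with (2 := HL z Hz). exact (Hdelta z (t, (x, (v, tt))) Hc).
Qed.

Lemma periodic_box_bounded (T a b : R) (D : R -> R -> R -> R) :
  0 < T -> (forall x v, periodic T (fun t => D t x v)) ->
  (forall p, continuous (fun '(t, x, v) => D t x v) p) ->
  exists L, forall t x v, a <= x <= b -> -1 <= v <= 1 -> Rabs (D t x v) <= L.
Proof.
  intros HT Hper Hc.
  destruct (continuous_box_bounded _ 0 T a b (-1) 1 Hc) as (L & HL).
  exists L. intros t x v Hx Hv.
  destruct (periodic_representative T t HT) as (s & Hs & E).
  rewrite (E _ (Hper x v)). now apply (HL s x v).
Qed.

Lemma Rabs_diff_le_of_Derive_bounded (h : R -> R) (a b L : R) :
  (forall x, ex_derive h x) -> (forall x, a <= x <= b -> Rabs (Derive h x) <= L) ->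
  forall x y, a <= x <= b -> a <= y <= b -> Rabs (h x - h y) <= L * Rabs (x - y).
Proof.
  intros Hh HL x y Hx Hy.
  destruct (mean_value h (Derive h) y x) as (c & Hc & ->).
  { intros z; now apply Derive_correct. }
  rewrite Rabs_mult. apply Rmult_le_compat_r; [apply Rabs_pos|]. apply HL.
  revert Hc. unfold Rmin, Rmax; destruct (Rle_dec y x); lra.
Qed.

(** One variable is changed at a time. Each partial derivative is periodic in time, hence bounded on
    the strip by its bound over one period. *)
Lemma of_class_C1_3_lipschitz (T a b : R) (f : R -> R -> R -> R) :
  0 < T -> (forall x v, periodic T (fun t => f t x v)) -> of_class_C1_3 f ->
  exists L, 0 <= L /\ forall t s x y v w, a <= x <= b -> a <= y <= b ->
    -1 <= v <= 1 -> -1 <= w <= 1 ->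
    Rabs (f t x v - f s y w) <= L * (Rabs (t - s) + Rabs (x - y) + Rabs (v - w)).
Proof.
  intros HT Hper (Hex & Hcont).
  destruct (periodic_box_bounded T a b (fun t x v => Derive (fun s => f s x v) t))
    as (L1 & HL1); try assumption.
  { intros x v. apply (periodic_derive T (fun s => f s x v)); [|apply Hper].
    intros t. apply Derive_correct. exact (proj1 (Hex t x v)). }
  { intros p; apply Hcont. }
  destruct (periodic_box_bounded T a b (fun t x v => Derive (fun y => f t y v) x))
    as (L2 & HL2); try assumption.
  { intros x v t. apply Derive_ext. intros y; apply Hper. }
  { intros p; apply Hcont. }
  destruct (periodic_box_bounded T a b (fun t x v => Derive (fun w => f t x w) v))
    as (L3 & HL3); try assumption.
  { intros x v t. apply Derive_ext. intros y; apply Hper. }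
  { intros p; apply Hcont. }
  set (L := Rmax 0 (Rmax L1 (Rmax L2 L3))).
  assert (HL : 0 <= L /\ L1 <= L /\ L2 <= L /\ L3 <= L).
  { unfold L. assert (H1 := Rmax_l 0 (Rmax L1 (Rmax L2 L3))).
    assert (H2 := Rmax_r 0 (Rmax L1 (Rmax L2 L3))).
    assert (H3 := Rmax_l L1 (Rmax L2 L3)). assert (H4 := Rmax_r L1 (Rmax L2 L3)).
    assert (H5 := Rmax_l L2 L3). assert (H6 := Rmax_r L2 L3). lra. }
  exists L. split; [apply HL|]. intros t s x y v w Hx Hy Hv Hw.
  assert (D1 : Rabs (f t x v - f s x v) <= L * Rabs (t - s)).
  { apply (Rabs_diff_le_of_Derive_bounded (fun t => f t x v) (Rmin t s) (Rmax t s)).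
    - intros z. exact (proj1 (Hex z x v)).
    - intros z _. apply Rle_trans with L1; [now apply HL1|lra].
    - split; [apply Rmin_l|apply Rmax_l].
    - split; [apply Rmin_r|apply Rmax_r]. }
  assert (D2 : Rabs (f s x v - f s y v) <= L * Rabs (x - y)).
  { apply (Rabs_diff_le_of_Derive_bounded (fun x => f s x v) a b); try assumption.
    - intros z. exact (proj1 (proj2 (Hex s z v))).
    - intros z Hz. apply Rle_trans with L2; [now apply HL2|lra]. }
  assert (D3 : Rabs (f s y v - f s y w) <= L * Rabs (v - w)).
  { apply (Rabs_diff_le_of_Derive_bounded (fun v => f s y v) (-1) 1); try assumption.
    - intros z. exact (proj2 (proj2 (Hex s y z))).
    - intros z Hz. apply Rle_trans with L3; [now apply HL3|lra]. }
  replace (f t x v - f s y w) with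
    ((f t x v - f s x v) + ((f s x v - f s y v) + (f s y v - f s y w))) by ring.
  apply Rle_trans with (1 := Rabs_triang _ _).
  assert (H := Rabs_triang (f s x v - f s y v) (f s y v - f s y w)). lra.
Qed.

(** * The clipped field *)

Definition clip (v : R) : R := Rmax (-1) (Rmin 1 v).

Lemma clip_range (v : R) : -1 <= clip v <= 1.
Proof. unfold clip, Rmax, Rmin; repeat destruct Rle_dec; lra. Qed.

Lemma clip_id (v : R) : -1 <= v <= 1 -> clip v = v.
Proof. unfold clip, Rmax, Rmin; repeat destruct Rle_dec; lra. Qed.

Lemma clip_lipschitz (v w : R) : Rabs (clip v - clip w) <= Rabs (v - w).
Proof.
  unfold clip, Rmax, Rmin, Rabs; repeat destruct Rle_dec; repeat destruct Rcase_abs; lra.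
Qed.

(* [Rpower (1 - v ^ 2) (3 / 2)] would not do: its value at [v = 1] and [v = -1] is [1], since
   [ln 0 = 0], while [weight] must vanish there. *)
Definition weight (v : R) : R := (1 - v ^ 2) * sqrt (1 - v ^ 2).

Lemma weight_Rpower (v : R) :
  Rabs v < 1 -> Rpower (1 - v ^ 2) (3 / 2) = weight v.
Proof.
  intros Hv. apply Rabs_lt_between in Hv. assert (H : 0 < 1 - v ^ 2) by nra.
  unfold weight. replace (3 / 2) with (1 + / 2) by field.
  now rewrite Rpower_plus, Rpower_1, Rpower_sqrt.
Qed.

Lemma weight_range (v : R) : -1 <= v <= 1 -> 0 <= weight v <= 1.
Proof.
  intros Hv. unfold weight. assert (H : 0 <= 1 - v ^ 2 <= 1) by nra.
  assert (0 <= sqrt (1 - v ^ 2)) by apply sqrt_pos.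
  assert (H1 : sqrt (1 - v ^ 2) <= sqrt 1) by (apply sqrt_le_1; lra).
  rewrite sqrt_1 in H1.
  split; [apply Rmult_le_pos; lra|].
  apply Rle_trans with (1 * 1); [apply Rmult_le_compat; lra|lra].
Qed.

(** The square root is not Lipschitz at 0, but its cube is controlled by its square: a difference of
    cubes costs a factor 2, and [|v^2 - w^2| <= 2 |v - w|] another. *)
Lemma weight_lipschitz (v w : R) :
  -1 <= v <= 1 -> -1 <= w <= 1 -> Rabs (weight v - weight w) <= 4 * Rabs (v - w).
Proof.
  intros Hv Hw. unfold weight.
  set (x := sqrt (1 - v ^ 2)). set (y := sqrt (1 - w ^ 2)).
  assert (Ex : 1 - v ^ 2 = x * x) by (unfold x; rewrite sqrt_sqrt; nra).
  assert (Ey : 1 - w ^ 2 = y * y) by (unfold y; rewrite sqrt_sqrt; nra).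
  assert (Hx : 0 <= x) by apply sqrt_pos. assert (Hy : 0 <= y) by apply sqrt_pos.
  rewrite Ex, Ey.
  assert (x <= 1) by nra. assert (y <= 1) by nra.
  (* [|x^3 - y^3| <= 2 |x^2 - y^2|] since [x^2 + x y + y^2 <= 2 (x + y)] on [[0,1]]. *)
  assert (H1 : Rabs (x * x * x - y * y * y) <= 2 * Rabs ((x - y) * (x + y))).
  { replace (x * x * x - y * y * y) with ((x - y) * (x * x + x * y + y * y)) by ring.
    rewrite !Rabs_mult, (Rabs_pos_eq (x + y)), (Rabs_pos_eq (x * x + x * y + y * y)) by nra.
    assert (0 <= Rabs (x - y)) by apply Rabs_pos.
    assert (x * x + x * y + y * y <= 2 * (x + y)) by nra. nra. }
  apply Rle_trans with (1 := H1).
  replace ((x - y) * (x + y)) with ((w - v) * (w + v)) by lra.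
  rewrite Rabs_mult, (Rabs_minus_sym w v).
  assert (Rabs (w + v) <= 2) by (apply Rabs_le; lra).
  assert (0 <= Rabs (v - w)) by apply Rabs_pos. nra.
Qed.

Lemma weighted_field_lipschitz (T a b : R) (f : R -> R -> R -> R) :
  0 < T -> (forall x v, periodic T (fun t => f t x v)) -> of_class_C1_3 f ->
  exists K M, 0 <= K /\
    lipschitz_on a b K (fun t x v => weight (clip v) * f t x (clip v)) /\
    forall t x v, a <= x <= b -> Rabs (weight (clip v) * f t x (clip v)) <= M.
Proof.
  intros HT Hper Hf.
  destruct (of_class_C1_3_lipschitz T a b f HT Hper Hf) as (L & HL0 & HL).
  (* The value at one corner plus [L] times the largest displacements in time, position and
     velocity. The absolute value keeps [M] nonnegative even if [b < a]. *)
  set (M := Rabs (f 0 a 0) + L * (T + Rabs (b - a) + 1)).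
  assert (HM : forall t x v, a <= x <= b -> -1 <= v <= 1 -> Rabs (f t x v) <= M).
  { intros t x v Hx Hv.
    destruct (periodic_representative T t HT) as (s & Hs & E).
    rewrite (E _ (Hper x v)).
    assert (H := HL s 0 x a v 0 Hx (conj (Rle_refl a) (Rle_trans _ _ _ (proj1 Hx) (proj2 Hx)))
                   Hv ltac:(lra)).
    replace (f s x v) with (f 0 a 0 + (f s x v - f 0 a 0)) by ring.
    apply Rle_trans with (1 := Rabs_triang _ _). apply Rplus_le_compat_l.
    apply Rle_trans with (1 := H). apply Rmult_le_compat_l; [exact HL0|].
    assert (Rabs (s - 0) <= T) by (apply Rabs_le; lra).
    assert (Rabs (x - a) <= Rabs (b - a)) by (rewrite !Rabs_pos_eq; lra).
    assert (Rabs (v - 0) <= 1) by (apply Rabs_le; lra). lra. }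
  assert (HM0 : 0 <= M).
  { unfold M. assert (0 <= Rabs (f 0 a 0)) by apply Rabs_pos.
    assert (0 <= Rabs (b - a)) by apply Rabs_pos. nra. }
  (* Product rule: [L] comes from [f] with weight at most 1, and [4 * M] from the weight with [f] at
     most [M]. *)
  exists (L + 4 * M), M. split; [lra|split].
  - intros t s x y v w Hx Hy.
    assert (Cv := clip_range v). assert (Cw := clip_range w).
    assert (C := clip_lipschitz v w).
    assert (H1 := HL t s x y _ _ Hx Hy Cv Cw).
    assert (H2 := weight_lipschitz _ _ Cv Cw).
    assert (H3 := weight_range _ Cv). assert (H4 := HM s y _ Hy Cw).
    replace (_ - _) with (weight (clip v) * (f t x (clip v) - f s y (clip w)) +
      (weight (clip v) - weight (clip w)) * f s y (clip w)) by ring.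
    apply Rle_trans with (1 := Rabs_triang _ _).
    rewrite !Rabs_mult, (Rabs_pos_eq (weight (clip v))) by lra.
    assert (P1 := Rabs_pos (t - s)). assert (P2 := Rabs_pos (x - y)).
    assert (P3 := Rabs_pos (f t x (clip v) - f s y (clip w))).
    set (d := Rabs (v - w)) in *. set (e := Rabs (t - s) + Rabs (x - y)) in *.
    assert (A1 : weight (clip v) * Rabs (f t x (clip v) - f s y (clip w)) <= L * (e + d)) by nra.
    assert (A2 : Rabs (weight (clip v) - weight (clip w)) * Rabs (f s y (clip w)) <= 4 * d * M).
    { apply Rmult_le_compat; try apply Rabs_pos; lra. }
    assert (0 <= M * e) by (apply Rmult_le_pos; unfold e; lra). lra.
  - intros t x v Hx. assert (Cv := clip_range v).
    assert (H3 := weight_range _ Cv). assert (H4 := HM t x _ Hx Cv).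
    rewrite Rabs_mult, (Rabs_pos_eq (weight (clip v))) by lra.
    assert (P := Rabs_pos (f t x (clip v))). nra.
Qed.

(** * Back from the clipped equation to the original one *)

Lemma periodic_speed_lt_1 (T a b K : R) (f : R -> R -> R -> R) (q p : R -> R) :
  0 < T -> periodic T q ->
  lipschitz_on a b K (fun t x v => weight (clip v) * f t x (clip v)) ->
  (forall t, a <= q t <= b) ->
  (forall t, is_derive q t (p t)) ->
  (forall t, is_derive p t (weight (clip (p t)) * f t (q t) (clip (p t)))) ->
  forall t, Rabs (p t) < 1.
Proof.
  intros HT Hper Hg Hq Dq Dp t.
  (* By periodicity the velocity vanishes at some [c]. If the speed were ever at least 1, the
     intermediate value theorem from [c] would give a time where [p] equals 1 or -1. *)
  destruct (mean_value q p 0 T Dq) as (c & _ & Hc).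
  assert (E := Hper 0). rewrite Rplus_0_l in E.
  assert (Hpc : p c = 0) by nra.
  (* The lines [q' = 1] and [q' = -1] solve the regularized equation, hence no other
     solution reaches the speed [1]. *)
  assert (NS : forall s t0, s ^ 2 = 1 -> p t0 <> s).
  { intros s t0 Hs H0.
    assert (Hs1 : clip s = s) by (apply clip_id; nra).
    assert (Z : p c - s = 0).
    { apply (gronwall_zero K t0 (fun t => p t - s)
               (fun t => weight (clip (p t)) * f t (q t) (clip (p t)))).
      - intros x. eapply is_derive_eq.
        + apply (is_derive_minus (V := R_NormedModule)); [apply Dp|apply is_derive_const].
        + unfold minus, plus, opp, zero; simpl. ring.
      (* The field vanishes at velocity [s] because [weight s = 0], so the Lipschitz bound reads
         [|p'| <= K |p - s|]. *)
      - intros x. assert (H := Hg x x (q x) (q x) (p x) s (Hq x) (Hq x)); cbv beta in H.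
        rewrite Hs1 in H. unfold weight at 2 in H.
        rewrite Hs, !Rminus_diag, Rabs_R0, !Rmult_0_l, Rminus_0_r, !Rplus_0_l in H. exact H.
      - lra. }
    nra. }
  apply Rnot_le_lt. intros H1.
  assert (Cp : continuity p).
  { intros x. apply continuity_pt_filterlim. exact (continuous_of_is_derive _ _ _ (Dp x)). }
  destruct (Rle_dec 0 (p t)) as [Hpos|Hneg].
  - rewrite Rabs_pos_eq in H1 by lra.
    destruct (IVT_gen p c t 1 Cp) as (t0 & _ & H0).
    + rewrite Hpc, Rmin_left, Rmax_right; lra.
    + apply (NS 1 t0); [ring|exact H0].
  - rewrite Rabs_left in H1 by lra.
    destruct (IVT_gen p c t (-1) Cp) as (t0 & _ & H0).
    + rewrite Hpc, Rmin_right, Rmax_left; lra.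
    + apply (NS (-1) t0); [ring|exact H0].
Qed.

(** The derivative of [v / sqrt (1 - v ^ 2)] is [/ weight v], which cancels the weight in the chain
    rule. *)
Lemma is_derive_relativistic_momentum (p : R -> R) (t F : R) :
  Rabs (p t) < 1 -> is_derive p t (weight (p t) * F) ->
  is_derive (fun s => p s / sqrt (1 - p s ^ 2)) t F.
Proof.
  intros Hv Hp. apply Rabs_lt_between in Hv.
  assert (H : 0 < 1 - p t ^ 2) by nra.
  assert (Hs : 0 < sqrt (1 - p t ^ 2)) by now apply sqrt_lt_R0.
  assert (Q : sqrt (1 - p t ^ 2) ^ 2 = 1 - p t ^ 2) by (apply pow2_sqrt; lra).
  assert (D : is_derive (fun v => 1 - v ^ 2) (p t) (- (2 * p t)))
    by (auto_derive; [trivial|ring]).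
  eapply is_derive_eq.
  - apply (is_derive_comp (V := R_NormedModule) (fun v => v / sqrt (1 - v ^ 2)) p);
      [|exact Hp].
    apply (is_derive_eq _ _ _ (/ weight (p t)) (is_derive_div (fun v => v) _ _ _ _
      (is_derive_id (K := R_AbsRing) _)
      (is_derive_sqrt (fun v => 1 - v ^ 2) (p t) _ D H) (Rgt_not_eq _ _ Hs))).
    unfold one, weight; cbn -[pow sqrt Rinv].
    set (r := sqrt (1 - p t ^ 2)) in *. rewrite <- Q.
    assert (E : p t * p t = 1 - r ^ 2) by lra.
    field_simplify_eq; [|lra]. ring [E].
  - unfold scal; simpl; unfold mult; simpl. unfold weight. field. split; lra.
Qed.

(** The cone condition is itself a Gronwall inequality for [v - u]. A single contact therefore makes
    [u] and [v] coincide everywhere, second derivatives included. *)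
Lemma cone_le_strict (k : R) (u u' u'' v v' v'' : R -> R) :
  0 < k -> cone_le k u u' v v' ->
  (forall t, is_derive u t (u' t)) -> (forall t, is_derive u' t (u'' t)) ->
  (forall t, is_derive v t (v' t)) -> (forall t, is_derive v' t (v'' t)) ->
  (forall t, u t = v t -> u' t = v' t -> u'' t <> v'' t) ->
  forall t, u t < v t.
Proof.
  intros Hk Hc Du Du' Dv Dv' Hne t.
  destruct (Rle_lt_or_eq _ _ (cone_le_le k _ _ _ _ Hk Hc t)) as [Hlt|E0]; [exact Hlt|exfalso].
  assert (E : forall s, v s - u s = 0).
  { apply (gronwall_zero k t _ (fun s => v' s - u' s)); [| |lra].
    - intros s. now apply (is_derive_minus (V := R_NormedModule)).
    - intros s. apply Rle_trans with (1 := Hc s).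
      apply Rmult_le_compat_l; [lra|apply Rle_abs]. }
  assert (Euv : u = v) by (apply functional_extensionality; intros s; specialize (E s); lra).
  assert (Euv' : u' = v').
  { apply functional_extensionality; intros s.
    rewrite <- (is_derive_unique _ _ _ (Du s)), Euv. now apply is_derive_unique. }
  apply (Hne t); [now rewrite Euv|now rewrite Euv'|].
  rewrite <- (is_derive_unique _ _ _ (Du' t)), Euv'. now apply is_derive_unique.
Qed.

Lemma of_class_C_2_is_derive (h : R -> R) :
  of_class_C 2 h ->
  (forall t, is_derive h t (Derive h t)) /\
  (forall t, is_derive (Derive h) t (Derive_n h 2 t)).
Proof.
  intros H. split; intros t; apply Derive_correct.
  - exact (proj1 (H 1%nat ltac:(lia) t)).
  - exact (proj1 (H 2%nat ltac:(lia) t)).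
Qed.

Lemma is_solution_of_regularized (f : R -> R -> R -> R) (q p : R -> R) :
  (forall t, Rabs (p t) < 1) ->
  (forall t, is_derive q t (p t)) ->
  (forall t, is_derive p t (weight (clip (p t)) * f t (q t) (clip (p t)))) ->
  (forall t, continuous (fun t => weight (clip (p t)) * f t (q t) (clip (p t))) t) ->
  is_solution f q.
Proof.
  intros Hp Dq Dp Hc.
  assert (Eq : Derive q = p)
    by (apply functional_extensionality; intros t; now apply is_derive_unique).
  assert (E2 : Derive_n q 2 = fun t => weight (clip (p t)) * f t (q t) (clip (p t))).
  { apply functional_extensionality; intros t. change (Derive (Derive q) t =
      weight (clip (p t)) * f t (q t) (clip (p t))).
    rewrite Eq. now apply is_derive_unique. }
  split; [|split].
  - intros [|[|[|n]]] Hn t; [| | |lia].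
    + split; [exact I|]. exact (continuous_of_is_derive _ _ _ (Dq t)).
    + split; [eexists; apply Dq|]. change (continuous (Derive q) t). rewrite Eq.
      exact (continuous_of_is_derive _ _ _ (Dp t)).
    + split; [|now rewrite E2].
      change (ex_derive (Derive q) t). rewrite Eq. eexists; apply Dp.
  - intros t. now rewrite Eq.
  - intros t. rewrite Eq. apply is_derive_relativistic_momentum; [apply Hp|].
    specialize (Dp t). rewrite clip_id in Dp; [exact Dp|].
    specialize (Hp t). apply Rabs_lt_between in Hp. lra.
Qed.

(** * Existence of the periodic solution *)

Theorem theorem2p8 (T : R) (f : R -> R -> R -> R) (h1 h2 : R -> R)
  (HT : 0 < T)
  (Hf_per : forall x v : R, periodic T (fun t => f t x v))
  (Hf_C1 : of_class_C1_3 f)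
  (Hh1_per : periodic T h1) (Hh1_C2 : of_class_C 2 h1)
  (Hh2_per : periodic T h2) (Hh2_C2 : of_class_C 2 h2)
  (Hlt : forall t : R, h1 t < h2 t)
  (Hh1_speed : forall t : R, Rabs (Derive h1 t) < 1)
  (Hh2_speed : forall t : R, Rabs (Derive h2 t) < 1)
  (Hh1 : forall t : R,
      Rpower (1 - Derive h1 t ^ 2) (3 / 2) * f t (h1 t) (Derive h1 t)
        - Derive_n h1 2 t < 0)
  (Hh2 : forall t : R,
      Rpower (1 - Derive h2 t ^ 2) (3 / 2) * f t (h2 t) (Derive h2 t)
        - Derive_n h2 2 t > 0) :
  exists q : R -> R,
    periodic T q /\ is_solution f q /\ (forall t : R, h1 t < q t < h2 t).
Proof.
  destruct (of_class_C_2_is_derive h1 Hh1_C2) as (D1 & D1').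
  destruct (of_class_C_2_is_derive h2 Hh2_C2) as (D2 & D2').
  assert (C1 : forall t, continuous h1 t) by (intros t; exact (continuous_of_is_derive _ _ _ (D1 t))).
  assert (C2 : forall t, continuous h2 t) by (intros t; exact (continuous_of_is_derive _ _ _ (D2 t))).
  destruct (periodic_max T (fun t => - h1 t) HT) as (m1 & Hm1).
  { intros t; now rewrite Hh1_per. }
  { intros t; now apply (continuous_opp (V := R_NormedModule)). }
  destruct (periodic_max T h2 HT Hh2_per C2) as (m2 & Hm2).
  destruct (periodic_max T (fun t => h1 t - h2 t) HT) as (m & Hm).
  { intros t; now rewrite Hh1_per, Hh2_per. }
  { intros t; now apply (continuous_minus (V := R_NormedModule)). }
  cbv beta in Hm1, Hm.
  (* The minimum of [h1], the maximum of [h2] and the smallest gap between them. *)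
  set (a := h1 m1). set (b := h2 m2). set (delta := h2 m - h1 m).
  assert (Hdelta : 0 < delta) by (unfold delta; specialize (Hlt m); lra).
  destruct (weighted_field_lipschitz T a b f HT Hf_per Hf_C1) as (K & M & HK & Hg & HM).
  set (g := fun t x v => weight (clip v) * f t x (clip v)) in *.
  (* [K + 1] is what the iteration requires. The term [2 / delta] puts [h1] below [h2] in the cone
     order: [|h2' - h1'| <= 2 <= k (h2 - h1)]. *)
  set (k := K + 1 + 2 / delta).
  assert (H2d : 0 < 2 / delta) by (apply Rdiv_lt_0_compat; lra).
  assert (Hk0 : 0 < k) by (unfold k; lra).
  assert (Hg_strip : forall h t, Rabs (Derive h t) < 1 ->
    g t (h t) (Derive h t) = Rpower (1 - Derive h t ^ 2) (3 / 2) * f t (h t) (Derive h t)).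
  { intros h t H. rewrite weight_Rpower by exact H. unfold g. rewrite clip_id; [reflexivity|].
    apply Rabs_lt_between in H. lra. }
  assert (G1 : forall t, g t (h1 t) (Derive h1 t) < Derive_n h1 2 t)
    by (intros t; rewrite Hg_strip by auto; specialize (Hh1 t); lra).
  assert (G2 : forall t, Derive_n h2 2 t < g t (h2 t) (Derive h2 t))
    by (intros t; rewrite Hg_strip by auto; specialize (Hh2 t); lra).
  destruct (periodic_solution_between T a b K M 1 k g h1 (Derive h1) h2 (Derive h2))
    as (q & p & Hq & Dq & Dp & H1q & Hq2); try assumption.
  - unfold k; lra.
  - intros x v t. unfold g. now rewrite Hf_per.
  - intros t; left; apply Hh1_speed.
  - intros t. specialize (Hm1 t). unfold a. lra.
  - split; [exact Hh1_per|split; [exact D1|]].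
    exists (Derive_n h1 2). split; [exact D1'|]. intros t; left; apply G1.
  - split; [exact Hh2_per|split; [exact D2|]].
    exists (Derive_n h2 2). split; [exact D2'|]. intros t; left; apply G2.
  - intros t. apply Rle_trans with 2.
    + assert (S1 := Hh1_speed t). assert (S2 := Hh2_speed t).
      apply Rabs_lt_between in S1. apply Rabs_lt_between in S2. apply Rabs_le. lra.
    + apply Rle_trans with (2 / delta * delta); [right; field; lra|].
      specialize (Hm t). apply Rmult_le_compat; unfold k, delta in *; lra.
  - assert (Hbox : forall t, a <= q t <= b).
    { intros t. assert (H1 := cone_le_le k _ _ _ _ Hk0 H1q t).
      assert (H2 := cone_le_le k _ _ _ _ Hk0 Hq2 t).
      specialize (Hm1 t). specialize (Hm2 t). unfold a, b. lra. }
    exists q. split; [exact Hq|split].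
    + apply (is_solution_of_regularized f q p); try assumption.
      * now apply (periodic_speed_lt_1 T a b K f q p).
      * intros t. apply (continuous_lipschitz_comp a b K g q p t Hg Hbox).
        -- exact (continuous_of_is_derive _ _ _ (Dq t)).
        -- exact (continuous_of_is_derive _ _ _ (Dp t)).
    + intros t. split.
      * apply (cone_le_strict k h1 (Derive h1) (Derive_n h1 2) q p (fun t => g t (q t) (p t)));
          try assumption.
        intros s E E' E''. specialize (G1 s). rewrite E, E', E'' in G1. lra.
      * apply (cone_le_strict k q p (fun t => g t (q t) (p t)) h2 (Derive h2) (Derive_n h2 2));
          try assumption.
        intros s E E' E''. specialize (G2 s). rewrite <- E, <- E', <- E'' in G2. lra.
Qed.
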